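(* Let $(X,d)$ be a compact metric space, let $f\colon X\to X$ be a continuous map, and let $N>0$ be an integer. Then $f$ is DC2' if and only if $f^N$ is DC2'.
   Context: Here $f^n$ denotes the $n$-fold iterate of $f$ and $\#$ denotes cardinality. For a metric space $(X,d)$, a continuous map $g\colon X\to X$, points $x,y\in X$ and $t>0$ put $$F(g,x,y,t)=\liminf_{n\to\infty}\frac1n\#\{i : d(g^i(x),g^i(y))<t,\ 0\le i<n\},$$ $$F^*(g,x,y,t)=\limsup_{n\to\infty}\frac1n\#\{i : d(g^i(x),g^i(y))<t,\ 0\le i<n\}.$$ The map $g$ is distributionally chaotic of type 2' (DC2') if there exists an uncountable subset $S\subseteq X$ such that for every pair $x,y\in S$ of distinct points, $F(g,x,y,\varepsilon)=0$ for some $\varepsilon>0$ and $F^*(g,x,y,t)>0$ for all $t>0$. *)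

(* Defs.v *)
From HB Require Import structures.
From mathcomp Require Import all_boot all_order all_algebra.
From mathcomp Require Import all_classical all_reals all_analysis.

Set Implicit Arguments.
Unset Strict Implicit.
Unset Printing Implicit Defensive.

Import Order.TTheory GRing.Theory Num.Theory.

Local Open Scope classical_set_scope.
Local Open Scope ring_scope.

(* The value at n = 0 is 0 / 0 = 0. All values lie in [0, 1], so the real-valued
   limn_inf and limn_sup below are the true lower and upper limits. *)
Definition close_freq (R : realType) (X : metricType R) (g : X -> X)
    (x y : X) (t : R) (n : nat) : R :=
  #|[pred i : 'I_n | mdist (iter i g x) (iter i g y) < t]|%:R / n%:R.

Definition lower_distr (R : realType) (X : metricType R) (g : X -> X)
    (x y : X) (t : R) : R :=
  limn_inf (close_freq g x y t).

Definition upper_distr (R : realType) (X : metricType R) (g : X -> X)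
    (x y : X) (t : R) : R :=
  limn_sup (close_freq g x y t).

Definition DC2' (R : realType) (X : metricType R) (g : X -> X) : Prop :=
  exists S : set X,
    ~ countable S /\
    forall x y : X, S x -> S y -> x <> y ->
      (exists eps : R, 0 < eps /\ lower_distr g x y eps = 0) /\
      (forall t : R, 0 < t -> 0 < upper_distr g x y t).

(* Main.v *)
Require Import Defs.
From mathcomp Require Import all_boot all_order all_algebra.
From mathcomp Require Import all_classical all_reals all_analysis.
From mathcomp Require Import zify lra.

Set Implicit Arguments.
Unset Strict Implicit.
Unset Printing Implicit Defensive.

Import Order.TTheory GRing.Theory Num.Theory.
Import numFieldNormedType.Exports.

Local Open Scope classical_set_scope.
Local Open Scope ring_scope.

(** The same scrambled set serves [f] and its iterate [f^N], because the two
    conditions on a pair [x, y] are equivalent for both maps.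

    By compactness, [f, ..., f^N] are uniformly continuous with a common
    modulus: for each [t] there is [s] such that two orbits which are [s]-close
    at some time stay [t]-close during the next [N] steps
    ([compact_iter_modulus]).  Cut time into blocks of length [N], block [k]
    being the times [kN, ..., kN + N - 1]; its first time is the [k]-th time of
    [f^N].  If the [f^N]-orbits are [s]-close at time [k], the [f]-orbits are
    [t]-close during all of block [k] ([hits_spread]).  If the [f]-orbits are
    [s]-close anywhere in block [k], the [f^N]-orbits are [t]-close at time
    [k + 1] ([hits_gather]).  So each frequency of closeness is bounded, up to
    a change of threshold, a bounded factor and a rescaling of time, by the
    other one.  Such bounds transport both [liminf = 0] and [limsup > 0]
    ([density_le_freq]): the definition of DC2' asks only whether the upper
    frequencies are positive, so the lost constants do no harm, and since it
    asks for some [eps] in one condition and for all [t] in the other, neither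
    does the change of threshold. *)

(** * Lower and upper limits of sequences with values in [0, 1] *)

Section BoundedSequences.
Context {R : realType}.
Implicit Types u : R^nat.

Lemma bounded_fun01 u :
  (forall n, 0 <= u n <= 1) -> bounded_fun (u : nat -> R^o).
Proof.
move=> u01; exists 1; split; first exact: num_real.
move=> M M1 n _ /=; have /andP[u0 u1] := u01 n.
by rewrite ger0_norm// (le_trans u1)// ltW.
Qed.

Lemma limn_inf_eq0P u : (forall n, 0 <= u n <= 1) ->
  limn_inf u = 0 <->
  forall e, 0 < e -> forall M, exists2 n, (M <= n)%N & u n < e.
Proof.
move=> u01; have ub := bounded_fun01 u01.
have lb n : has_lbound (sdrop u n).
  exact/has_lbound_sdrop/bounded_fun_has_lbound.
have ubi : has_ubound (range (infs u)) by exact: bounded_fun_has_ubound_infs.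
rewrite limn_infE//; split => [u0 e e0 M|freq].
- have : infs u M < e.
    by rewrite (le_lt_trans _ e0)// -u0; apply: ub_le_sup => //.
  have ne : sdrop u M !=set0 by exists (u M), M => /=.
  by move=> /(inf_lt ne)[_ [n /= Mn <-] une]; exists n.
- apply/eqP; rewrite eq_le; apply/andP; split.
    apply: ge_sup; first by exists (infs u 0%N), 0%N.
    move=> _ [M _ <-]; apply/ler_addgt0Pr => e e0; rewrite add0r.
    have [n Mn /ltW] := freq _ e0 M; apply: le_trans.
    by apply: ge_inf => //; exists n.
  rewrite (@le_trans _ _ (infs u 0%N))//; last first.
    by apply: ub_le_sup => //; exists 0%N.
  apply: lb_le_inf; first by exists (u 0%N), 0%N.
  by move=> _ [n _ <-]; have /andP[] := u01 n.
Qed.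

Lemma limn_sup_gt0P u : (forall n, 0 <= u n <= 1) ->
  0 < limn_sup u <->
  exists2 e, 0 < e & forall M, exists2 n, (M <= n)%N & e <= u n.
Proof.
move=> u01; have ub := bounded_fun01 u01.
have ubd n : has_ubound (sdrop u n).
  exact/has_ubound_sdrop/bounded_fun_has_ubound.
have lbs : has_lbound (range (sups u)) by exact: bounded_fun_has_lbound_sups.
rewrite limn_supE//; set L := inf _; split => [L0|[e e0 freq]].
- exists (L / 2); first by rewrite divr_gt0.
  move=> M; have : L / 2 < sups u M.
    apply: (@lt_le_trans _ _ L); first by lra.
    by apply: ge_inf => //; exists M.
  have ne : sdrop u M !=set0 by exists (u M), M => /=.
  by move=> /(sup_gt ne)[_ [n /= Mn <-] /ltW une]; exists n.
- apply: (lt_le_trans e0); apply: lb_le_inf; first by exists (sups u 0%N), 0%N.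
  move=> _ [M _ <-]; have [n Mn] := freq M; move/le_trans; apply.
  by apply: ub_le_sup => //; exists n.
Qed.

End BoundedSequences.

(** * Counting along blocks of length N *)

Definition hits (P : pred nat) (n : nat) : nat := \sum_(0 <= i < n) P i.

Lemma leq_hits P : {homo hits P : m n / (m <= n)%N}.
Proof.
move=> m n mn; rewrite /hits (big_cat_nat (leq0n m) mn) /=; exact: leq_addr.
Qed.

Lemma hits_mul P q N :
  hits P (q * N) = (\sum_(0 <= k < q) \sum_(0 <= r < N) P (k * N + r))%N.
Proof.
rewrite /hits big_nat_mul; apply: eq_bigr => k _.
rewrite -{1}[(k * N)%N]add0n big_addn mulSn addnK.
by apply: eq_bigr => r _; rewrite addnC.
Qed.

(** Every hit [k] of [P] yields a whole block of [N] hits of [Q]; only the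
    [n %/ N] complete blocks before [n] are used. *)
Lemma hits_spread (P Q : pred nat) N n :
  (forall k r, (r < N)%N -> P k -> Q (k * N + r)%N) ->
  (hits P (n %/ N) * N <= hits Q n)%N.
Proof.
move=> PQ; apply: leq_trans (leq_hits Q (leq_divM n N)).
rewrite hits_mul /hits big_distrl /=; apply: leq_sum => k _.
have -> : (P k * N = \sum_(0 <= r < N) P k)%N.
  by rewrite sum_nat_const_nat subn0 mulnC.
rewrite !big_nat.
apply: leq_sum => r /andP[_ rN].
by case: (boolP (P k)) => // /(PQ _ _ rN) ->.
Qed.

(** All hits of [P] in block [k] are charged to the single hit [k + 1] of [Q],
    at most [N] of them.  The successors: one for the last, possibly incomplete,
    block and one for the shift from [k] to [k + 1]. *)
Lemma hits_gather (P Q : pred nat) N n : (0 < N)%N ->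
  (forall k r, (r < N)%N -> P (k * N + r)%N -> Q k.+1) ->
  (hits P n <= hits Q (n %/ N).+2 * N)%N.
Proof.
move=> N0 PQ; have le_n : (n <= (n %/ N).+1 * N)%N by rewrite ltnW// ltn_ceil.
apply: leq_trans (leq_hits P le_n) _.
rewrite hits_mul /hits [in leqRHS]big_nat_recl//= mulnDl.
apply: leq_trans (leq_addl _ _).
rewrite big_distrl /=; apply: leq_sum => k _.
have -> : (Q k.+1 * N = \sum_(0 <= r < N) Q k.+1)%N.
  by rewrite sum_nat_const_nat subn0 mulnC.
rewrite !big_nat.
apply: leq_sum => r /andP[_ rN].
by case: (boolP (P _)) => // /(PQ _ _ rN) ->.
Qed.

(** * Comparing densities of sets of times *)

Section Frequencies.
Context {R : realType}.

Definition freq (P : pred nat) : R^nat := fun n => (hits P n)%:R / n%:R.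

Lemma freq01 P n : 0 <= freq P n <= 1.
Proof.
rewrite /freq divr_ge0//=; case: n => [|n]; first by rewrite invr0 mulr0.
rewrite ler_pdivrMr ?ltr0n// mul1r ler_nat /hits big_mkord.
rewrite -[leqRHS]card_ord -sum1_card; apply: leq_sum => i _; exact: leq_b1.
Qed.

Lemma ler_ratio (a b m n C : nat) : (0 < m)%N -> (0 < n)%N ->
  (a * n <= C * (b * m))%N -> a%:R / m%:R <= C%:R * (b%:R / n%:R) :> R.
Proof.
move=> m0 n0 h; rewrite ler_pdivrMr ?ltr0n// mulrA mulrAC.
by rewrite ler_pdivlMr ?ltr0n// -!natrM ler_nat -mulnA.
Qed.

(** The only trace of a comparison of densities up to a constant factor that
    matters for DC2'. *)
Definition density_le (P Q : pred nat) : Prop :=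
  (limn_inf (freq Q) = 0 -> limn_inf (freq P) = 0) /\
  (0 < limn_sup (freq P) -> 0 < limn_sup (freq Q)).

(** The bound [freq P m <= C * freq Q n] need only hold for pairs of times
    [(m, n)] that are cofinal in two ways.  For the lower limit, small
    frequencies of [Q] are given, so every large [n] needs a large partner [m];
    for the upper limit, large frequencies of [P] are given, so every large [m]
    needs a large partner [n]. *)
Lemma density_le_freq (P Q : pred nat) (C : R) : 0 < C ->
  (forall M, exists K, forall n, (K <= n)%N ->
     exists2 m, (M <= m)%N & freq P m <= C * freq Q n) ->
  (forall M, exists K, forall m, (K <= m)%N ->
     exists2 n, (M <= n)%N & freq P m <= C * freq Q n) ->
  density_le P Q.
Proof.
move=> C0 cmpP cmpQ; split.
- move/(limn_inf_eq0P (freq01 Q)) => Q0; apply/(limn_inf_eq0P (freq01 P)).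
  move=> e e0 M; have [K cmp] := cmpP M.
  have [n /cmp[m Mm PQ] Qn] := Q0 _ (divr_gt0 e0 C0) K.
  by exists m => //; rewrite (le_lt_trans PQ)// mulrC -ltr_pdivlMr.
- move/(limn_sup_gt0P (freq01 P)) => [e e0 Pe].
  apply/(limn_sup_gt0P (freq01 Q)).
  exists (e / C); first by rewrite divr_gt0.
  move=> M; have [K cmp] := cmpQ M; have [m /cmp[n Mn PQ] eP] := Pe K.
  by exists n => //; rewrite ler_pdivrMr// mulrC (le_trans eP).
Qed.

(** The times are paired as [(n %/ N, n)]. *)
Lemma density_le_spread (P Q : pred nat) N : (0 < N)%N ->
  (forall k r, (r < N)%N -> P k -> Q (k * N + r)%N) -> density_le P Q.
Proof.
move=> N0 PQ.
(* the factor 2 absorbs the remainder: n < (n %/ N + 1) * N <= 2 * (n %/ N) * N *)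
have cmp n : (N <= n)%N -> freq P (n %/ N)%N <= 2 * freq Q n.
  move=> Nn; have q0 : (0 < n %/ N)%N by rewrite divn_gt0.
  apply: ler_ratio => //; first exact: leq_trans Nn.
  have := hits_spread n PQ; have := ltn_ceil n N0; nia.
apply: (@density_le_freq _ _ 2) => // M.
- exists (maxn 1 M * N)%N => n Mn; exists (n %/ N)%N.
    by rewrite leq_divRL//; nia.
  by apply: cmp; nia.
- exists (maxn 1 M) => m Mm; exists (m * N)%N; first by nia.
  by rewrite -{1}(mulnK m N0); apply: cmp; nia.
Qed.

(** The times are paired as [(n, n %/ N + 2)]. *)
Lemma density_le_gather (P Q : pred nat) N : (0 < N)%N ->
  (forall k r, (r < N)%N -> P (k * N + r)%N -> Q k.+1) -> density_le P Q.
Proof.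
move=> N0 PQ.
(* the factor 3 absorbs the shift: (n %/ N + 2) * N <= n + 2 * N <= 3 * n *)
have cmp n : (N <= n)%N -> freq P n <= 3 * freq Q (n %/ N).+2%N.
  move=> Nn; apply: ler_ratio => //; first exact: leq_trans Nn.
  have := hits_gather n N0 PQ; have := leq_divM n N; nia.
apply: (@density_le_freq _ _ 3) => // M.
- exists (M + 3)%N => n Mn; exists ((n - 2) * N)%N; first by nia.
  have {2}-> : n = ((n - 2) * N %/ N).+2%N by rewrite mulnK//; lia.
  by apply: cmp; nia.
- exists (maxn 1 M * N)%N => m Mm; exists (m %/ N).+2%N.
    have : (M <= m %/ N)%N by rewrite leq_divRL//; nia.
    by move/leq_trans; apply; rewrite leqW.
  by apply: cmp; nia.
Qed.

End Frequencies.

(** * A common modulus of continuity for the iterates *)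

Section UniformContinuity.
Context {R : realType} {X : metricType R}.

(** Heine's theorem.  Compactness is used in the near-covering form: a property
    of [s] and [x] that holds for [s] near [0] and points near any given [x]
    holds, for [s] near [0], at all points simultaneously. *)
Lemma compact_mdist_modulus (f : X -> X) :
  compact [set: X] -> continuous f -> forall t : R, 0 < t ->
  exists2 s : R, 0 < s & forall x y, mdist x y < s -> mdist (f x) (f y) < t.
Proof.
move=> /compact_near_coveringP cptX fc t t0.
have t20 : 0 < t / 2 by rewrite divr_gt0.
have near_mod : \forall s \near (0 : R)^'+,
    [set: X] `<=` (fun x => forall y, mdist x y < s -> mdist (f x) (f y) < t).
  apply: cptX.
  move=> x _.
  have : \forall y \near x, ball (f x) (t / 2) (f y).
    by apply: (fc x); exact: nbhsx_ballx.
  move=> /nbhs_ballP[d /= d0 fball].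
  have d20 : 0 < d / 2 by rewrite divr_gt0.
  near=> x' s => y x'y.
  have xx' : ball x (d / 2) x' by near: x'; exact: nbhsx_ballx.
  have sd : s <= d / 2 by near: s; exact: nbhs_right_le.
  have x'y' : ball x' (d / 2) y by rewrite ballEmdist/= (lt_le_trans x'y).
  have fx' : ball (f x) (t / 2) (f x').
    by apply: fball; apply: le_ball xx'; lra.
  have fy : ball (f x) (t / 2) (f y).
    by apply: fball; rewrite (splitr d); exact: ball_triangle x'y'.
  have := ball_triangle (ball_sym fx') fy.
  by rewrite -splitr ballEmdist.
near (0 : R)^'+ => s.
exists s; first by near: s; exact: nbhs_right_gt.
move=> x; have: [set: X] x by [].
by move: x; near: s.
Unshelve. all: by end_near. Qed.

Lemma compact_iter_modulus (f : X -> X) N :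
  compact [set: X] -> continuous f -> forall t : R, 0 < t ->
  exists2 s : R, 0 < s & forall j x y, (j <= N)%N ->
    mdist x y < s -> mdist (iter j f x) (iter j f y) < t.
Proof.
move=> cptX fc; elim: N => [|N IH] t t0.
  by exists t => // j x y; rewrite leqn0 => /eqP ->.
have [s1 s10 fs1] := compact_mdist_modulus cptX fc t0.
have min0 : 0 < Num.min s1 t by rewrite lt_min s10.
have [s s0 fs] := IH _ min0.
exists s => // j x y; rewrite leq_eqVlt => /predU1P[->|jN] xy.
  by apply: fs1; have := fs N x y (leqnn N) xy; rewrite lt_min => /andP[].
by have := fs j x y jN xy; rewrite lt_min => /andP[].
Qed.

End UniformContinuity.

(** * Pairs of orbits under a map and under its iterate *)

Section ScrambledPairs.
Context {R : realType} {X : metricType R}.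
Implicit Types (f g : X -> X) (x y : X) (t : R).

Definition close_times g x y t : pred nat :=
  fun i => mdist (iter i g x) (iter i g y) < t.

Lemma close_freqE g x y t : close_freq g x y t = freq (close_times g x y t).
Proof.
apply/funext => n; rewrite /close_freq /freq /hits big_mkord -sum1_card.
by rewrite big_mkcond.
Qed.

Definition DC2'_pair g x y :=
  (exists eps : R, 0 < eps /\ lower_distr g x y eps = 0) /\
  (forall t : R, 0 < t -> 0 < upper_distr g x y t).

(** The first bound makes the lower frequency of [h] vanish at some threshold,
    the second makes the upper frequency of [h] positive at each threshold. *)
Lemma DC2'_pair_transfer g h x y :
  (forall t, 0 < t -> exists2 s, 0 < s &
     density_le (R := R) (close_times h x y s) (close_times g x y t)) ->
  (forall t, 0 < t -> exists2 s, 0 < s &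
     density_le (R := R) (close_times g x y s) (close_times h x y t)) ->
  DC2'_pair g x y -> DC2'_pair h x y.
Proof.
move=> hg gh [[eps [eps0 low]] upp]; split.
- have [s s0 [+ _]] := hg _ eps0; rewrite -!close_freqE => /(_ low) ?.
  by exists s.
- move=> t t0; have [s s0 [_]] := gh _ t0.
  by rewrite -!close_freqE; apply; exact: upp.
Qed.

Lemma DC2'_pair_iter f N x y :
  compact [set: X] -> continuous f -> (0 < N)%N ->
  DC2'_pair f x y <-> DC2'_pair (iter N f) x y.
Proof.
move=> cptX fc N0.
have toG t : 0 < t -> exists2 s, 0 < s & density_le (R := R)
    (close_times (iter N f) x y s) (close_times f x y t).
  move=> t0; have [s s0 fs] := compact_iter_modulus N cptX fc t0.
  exists s => //; apply: (density_le_spread N0) => k r /ltnW rN.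
  by rewrite /close_times -!iterM addnC !iterD; exact: fs.
have toF t : 0 < t -> exists2 s, 0 < s & density_le (R := R)
    (close_times f x y s) (close_times (iter N f) x y t).
  move=> t0; have [s s0 fs] := compact_iter_modulus N cptX fc t0.
  exists s => //; apply: (density_le_gather N0) => k r rN.
  (* from inside block k, the start of block k + 1 is at most N steps away *)
  have e : (k.+1 * N = (N - r) + (k * N + r))%N by nia.
  by rewrite /close_times -!iterM e !(iterD (N - r)); apply: fs; rewrite leq_subr.
by split; apply: DC2'_pair_transfer.
Qed.

End ScrambledPairs.

Theorem theorem2 (R : realType) (X : metricType R) (f : X -> X) (N : nat) :
  compact [set: X] -> continuous f -> (0 < N)%N ->
  (DC2' f <-> DC2' (iter N f)).
Proof.
move=> cptX fc N0; split=> -[S [uncS pairS]]; exists S; split=> // x y Sx Sy xy.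
all: exact/(DC2'_pair_iter x y cptX fc N0)/pairS.
Qed.
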